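(* In the discrete setting described in the context, let $r$ be a positive integer with $\sigma_r>0$ (so $r\le s_X$). Then $$\sum_{j=1}^{s}\gamma_j\,\|Lw_j-L\Pi_r^X w_j\|_Y^2=\sum_{k=r+1}^{s_X}\sigma_k^2\,\|L\varphi_k\|_Y^2$$ and $$\sum_{j=1}^{s}\gamma_j\,\|Lw_j-\Pi_r^{Y}Lw_j\|_Y^2=\sum_{k=r+1}^{s_X}\sigma_k^2\,\|L\varphi_k-\Pi_r^Y L\varphi_k\|_Y^2 .$$ Also, if $L$ is invertible, then $$\sum_{j=1}^{s}\gamma_j\,\|w_j-L^{-1}\Pi_r^{Y}Lw_j\|_X^2=\sum_{k=r+1}^{s_X}\sigma_k^2\,\|\varphi_k-L^{-1}\Pi_r^Y L\varphi_k\|_X^2 .$$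
   Context: Scalars are $\mathbb{K}=\mathbb{R}$ or $\mathbb{C}$; inner products are linear in the first argument. $X,Y$ are separable Hilbert spaces and $L:\mathcal{D}(L)\subset X\to Y$ is a linear operator, possibly unbounded. ''Invertible'' means injective, with inverse $L^{-1}:\mathcal{D}(L^{-1})=\mathcal{R}(L)\subset Y\to X$. Discrete setting: $s$ is a positive integer, $\gamma_1,\dots,\gamma_s>0$ are weights, and $S=\mathbb{K}^s$ with inner product $(u,v)_S=\sum_{j=1}^s\gamma_j u_j\overline{v_j}$. The data is $\{w_j\}_{j=1}^s\subset\mathcal{D}(L)$. The POD operator is $K:S\to X$, $Kf=\sum_{j=1}^s\gamma_j f_j w_j$. It is compact with singular value decomposition $Kf=\sum_{k\ge1}\sigma_k(f,f_k)_S\varphi_k$, where $\sigma_1\ge\sigma_2\ge\dots\ge0$ and $\{f_k\}\subset S$, $\{\varphi_k\}\subset X$ are orthonormal singular vectors ($Kf_k=\sigma_k\varphi_k$, $K^*\varphi_k=\sigma_kf_k$ when $\sigma_k>0$). Set $s_X=\mathrm{rank}(K)<\infty$, so $\sigma_k>0$ exactly for $k\le s_X$; for such $k$, $\varphi_k=\sigma_k^{-1}Kf_k\in\mathcal{D}(L)$. For $r$ with $\sigma_r>0$: $X_r=\mathrm{span}\{\varphi_k\}_{k=1}^r\subset\mathcal{D}(L)$; $\Pi_r^X:X\to X$ is the orthogonal projection onto $X_r$; $Y_r=LX_r=\mathrm{span}\{L\varphi_k\}_{k=1}^r$; and $\Pi_r^Y:Y\to Y$ is a bounded linear projection onto $Y_r$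 (bounded, $(\Pi_r^Y)^2=\Pi_r^Y$, range $Y_r$), not necessarily orthogonal. *)

(* Defs.v *)
From HB Require Import structures.
From mathcomp Require Import all_boot all_order all_algebra.
From mathcomp Require Import complex.
From mathcomp Require Import all_classical all_reals all_analysis.

Set Implicit Arguments.
Unset Strict Implicit.
Unset Printing Implicit Defensive.

Import Order.TTheory GRing.Theory Num.Theory.
Import numFieldNormedType.Exports.

Local Open Scope classical_set_scope.
Local Open Scope ring_scope.

Inductive scalar_kind := RealScalars | ComplexScalars.

(* In R[i], [0 <= z] and [0 < z] imply that z is real, and norms take their
   values in the nonnegative elements of R[i] itself. So real quantities
   (weights, singular values, norms) are elements of the scalar field, with the
   order making them real. *)
Definition scalars (R : realType) (k : scalar_kind) : numFieldType :=
  match k with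
  | RealScalars => R
  | ComplexScalars => R[i]
  end.

Definition scalar_conj (R : realType) (k : scalar_kind) :
    {rmorphism scalars R k -> scalars R k} :=
  match k return {rmorphism scalars R k -> scalars R k} with
  | RealScalars => idfun
  | ComplexScalars => Num.conj
  end.

(* {dot X for theta} is the library's type of positive definite Hermitian
   forms; they are linear in the first argument. *)
Record sepHilbertType (R : realType) (k : scalar_kind) := SepHilbert {
  hilbert_sort :> completeNormedModType (scalars R k);
  inner : {dot hilbert_sort for scalar_conj R k};
  inner_norm : forall x : hilbert_sort, `|x| ^+ 2 = inner x x;
  separable : exists2 A : set hilbert_sort, countable A & dense A
}.

Section LinearAlgebra.
Variables (K : numFieldType) (V : lmodType K).

Definition lin_span (n : nat) (b : 'I_n -> V) : set V :=
  [set x | exists c : 'I_n -> K, x = \sum_i c i *: b i].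

Definition lin_free (n : nat) (b : 'I_n -> V) : Prop :=
  forall c : 'I_n -> K, \sum_i c i *: b i = 0 -> forall i, c i = 0.

Definition has_dim (A : set V) (n : nat) : Prop :=
  exists2 b : 'I_n -> V, lin_free b & A = lin_span b.

Definition projection_onto (A : set V) (P : {linear V -> V}) : Prop :=
  (forall x, P (P x) = P x) /\ range P = A.

Definition orthogonal_projection (ip : V -> V -> K) (A : set V)
    (P : {linear V -> V}) : Prop :=
  projection_onto A P /\ forall x v, A v -> ip (x - P x) v = 0.

End LinearAlgebra.

Definition has_rank (K : numFieldType) (U V : lmodType K) (T : U -> V)
  (n : nat) : Prop := has_dim (range T) n.

Definition bounded_operator (K : numFieldType) (V W : normedModType K)
  (T : V -> W) : Prop := exists M : K, forall x, `|T x| <= M * `|x|.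

Definition adjoint_operator (K : numFieldType) (U V : lmodType K)
  (ipU : U -> U -> K) (ipV : V -> V -> K) (T : U -> V) (T' : V -> U) : Prop :=
  forall u v, ipV (T u) v = ipU u (T' v).

(* A possibly unbounded linear operator. The underlying function is total, but
   only its values on [dom] are constrained. *)
Record linop (K : numFieldType) (X Y : lmodType K) := LinOp {
  dom : set X;
  linop_fun :> X -> Y;
  dom0 : dom 0;
  domP : forall (a : K) (x y : X), dom x -> dom y -> dom (a *: x + y);
  linopP : forall (a : K) (x y : X), dom x -> dom y ->
    linop_fun (a *: x + y) = a *: linop_fun x + linop_fun y
}.

Definition invertible (K : numFieldType) (X Y : lmodType K) (L : linop X Y) :
  Prop := {in dom L &, injective L}.

(* On the range [L @` dom L] this is the point of [dom L] that L maps to y;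
   elsewhere it is 0. *)
Definition linop_inv (K : numFieldType) (X Y : lmodType K) (L : linop X Y) :
  Y -> X := 'pinv_(fun=> 0) (dom L) L.

Definition weighted_inner (R : realType) (k : scalar_kind) (s : nat)
    (gamma : 'I_s -> scalars R k) (u v : 'rV[scalars R k]_s) : scalars R k :=
  \sum_j gamma j * u 0 j * scalar_conj R k (v 0 j).

Definition pod_operator (K : numFieldType) (X : lmodType K) (s : nat)
    (gamma : 'I_s -> K) (w : 'I_s -> X) (f : 'rV[K]_s) : X :=
  \sum_j (gamma j * f 0 j) *: w j.

(* Singular values and vectors are indexed from 1; index 0 is not used. The
   spaces may be finite-dimensional, so orthonormality is required only of the
   singular vectors that belong to nonzero singular values. *)
Record is_svd (K : numFieldType) (S : lmodType K) (X : normedModType K)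
    (ipS : S -> S -> K) (ipX : X -> X -> K) (T : S -> X)
    (sigma : nat -> K) (f : nat -> S) (phi : nat -> X) : Prop := IsSVD {
  svd_ge0 : forall k, (0 < k)%N -> 0 <= sigma k;
  svd_nonincreasing : forall k l, (0 < k <= l)%N -> sigma l <= sigma k;
  svd_orthonormal_l : forall k l, (0 < k)%N -> (0 < l)%N ->
    0 < sigma k -> 0 < sigma l -> ipS (f k) (f l) = (k == l)%:R;
  svd_orthonormal_r : forall k l, (0 < k)%N -> (0 < l)%N ->
    0 < sigma k -> 0 < sigma l -> ipX (phi k) (phi l) = (k == l)%:R;
  svd_apply : forall k, (0 < k)%N -> 0 < sigma k ->
    T (f k) = sigma k *: phi k;
  svd_adjoint : exists2 T' : X -> S, adjoint_operator ipS ipX T T' &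
    forall k, (0 < k)%N -> 0 < sigma k -> T' (phi k) = sigma k *: f k;
  svd_expansion : forall g : S,
    (fun n => \sum_(1 <= k < n.+1) (sigma k * ipS g (f k)) *: phi k) @ \oo
      --> T g
}.

Definition pod_space (K : numFieldType) (X : lmodType K) (phi : nat -> X)
  (r : nat) : set X := lin_span (fun i : 'I_r => phi i.+1).

(* Main.v *)
Require Import Defs.
From HB Require Import structures.
From mathcomp Require Import all_boot all_order all_algebra.
From mathcomp Require Import complex.
From mathcomp Require Import all_classical all_reals all_analysis.
From mathcomp Require Import ring.

(** All three identities are one statement about three different error
    operators E : X -> Z,
      E = L - L PX,   E = L - PY L,   E = 1 - L^-1 PY L,
    each linear on the domain of L.

    The singular value expansion, applied to the j-th coordinate vector divided
    by gamma_j, expresses the data as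
      w_j = sum_(k <= sX) sigma_k conj(f_k j) phi_k.
    The sum is finite because orthonormality of the f_k in the s-dimensional
    space S leaves room for at most s nonzero singular values, and the phi_k
    that belong to them form a basis of the range of the POD operator, so that
    their number is the rank sX ([sigma_gt0E]). A linear E may therefore be
    moved inside the sum without any continuity, which is what makes an
    unbounded L harmless. Expanding |E w_j|^2 and summing over j with the
    weights, the orthonormality of the f_k removes every cross term
    ([pod_sqnorm_sum]):
      sum_j gamma_j |E w_j|^2 = sum_(k <= sX) sigma_k^2 |E phi_k|^2.

    Each of the three operators E vanishes at phi_1, ..., phi_r, since PX fixes
    X_r and PY fixes L X_r, and so only the terms with k > r remain
    ([pod_sqnorm_tail]). In the first identity, PX also kills phi_k for k > r
    by orthogonality, hence E phi_k = L phi_k there. *)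

Set Implicit Arguments.
Unset Strict Implicit.
Unset Printing Implicit Defensive.

Import Order.TTheory GRing.Theory Num.Theory.
Import numFieldNormedType.Exports.

Local Open Scope classical_set_scope.
Local Open Scope ring_scope.

(** * Conjugation and inner products *)

Section ScalarConj.
Variables (R : realType) (kind : scalar_kind).
Implicit Types a : scalars R kind.

Lemma scalar_conjK a : scalar_conj R kind (scalar_conj R kind a) = a.
Proof. by case: kind a => [//|a]; apply: conjCK. Qed.

Lemma scalar_conj_ge0 a : 0 <= a -> scalar_conj R kind a = a.
Proof. by case: kind a => [//|a]; apply: geC0_conj. Qed.

End ScalarConj.

Section InnerProduct.
Variables (R : realType) (kind : scalar_kind) (X : sepHilbertType R kind).
Local Notation K := (scalars R kind).

Lemma inner_subl (x y z : X) : inner X (x - y) z = inner X x z - inner X y z.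
Proof. exact: linearBl. Qed.

Lemma inner_suml (n : nat) (a : 'I_n -> K) (x : 'I_n -> X) (z : X) :
  inner X (\sum_i a i *: x i) z = \sum_i a i * inner X (x i) z.
Proof. by rewrite linear_sumlz; apply: eq_bigr => i _; rewrite linearZl_LR. Qed.

Lemma inner_sumr (n : nat) (a : 'I_n -> K) (x : 'I_n -> X) (z : X) :
  inner X z (\sum_i a i *: x i)
  = \sum_i scalar_conj R kind (a i) * inner X z (x i).
Proof. by rewrite linear_sumr; apply: eq_bigr => i _; rewrite linearZr_LR. Qed.

Lemma inner_self_eq0 (x : X) : inner X x x = 0 -> x = 0.
Proof.
by move=> x0; apply/eqP; rewrite -normr_eq0 -sqrf_eq0 inner_norm x0.
Qed.

Lemma orthonormal_lin_free (n : nat) (e : 'I_n -> X) :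
  (forall i j, inner X (e i) (e j) = (i == j)%:R) -> lin_free e.
Proof.
move=> e_on c ce0 i.
have : inner X (\sum_j c j *: e j) (e i) = 0 by rewrite ce0 linear0l.
rewrite inner_suml (bigD1 i) //= e_on eqxx mulr1 big1 ?addr0 // => j ji.
by rewrite e_on (negbTE ji) mulr0.
Qed.

(** Pythagoras after averaging: for a single j the vectors [v i] need not be
    orthogonal, but the cross terms cancel once summed over j, because the rows
    of the coefficient matrix [c] are orthogonal for the weights [gamma]. *)
Lemma weighted_sqnorm_sum (s n : nat) (gamma : 'I_s -> K) (tau : 'I_n -> K)
    (c : 'I_n -> 'I_s -> K) (v : 'I_n -> X) :
  (forall i l, \sum_j gamma j * (c i j * scalar_conj R kind (c l j))
               = (i == l)%:R * tau i) ->
  \sum_j gamma j * `|\sum_i c i j *: v i| ^+ 2 = \sum_i tau i * `|v i| ^+ 2.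
Proof.
move=> c_orth.
under eq_bigr => j _.
  rewrite inner_norm inner_suml mulr_sumr.
  under eq_bigr => i _ do rewrite inner_sumr !mulr_sumr.
  over.
rewrite exchange_big /=; apply: eq_bigr => i _.
rewrite exchange_big /= (bigD1 i) //= [X in _ + X]big1 ?addr0 => [|l li].
  under eq_bigr => j _ do rewrite !mulrA -(mulrA (gamma j)).
  by rewrite -mulr_suml c_orth eqxx mul1r inner_norm.
under eq_bigr => j _ do rewrite !mulrA -(mulrA (gamma j)).
by rewrite -mulr_suml c_orth eq_sym (negbTE li) !mul0r.
Qed.

End InnerProduct.

(** * Uniqueness of the dimension *)

Section Dimension.
Variables (K : numFieldType) (V : lmodType K).

Lemma mem_lin_span (n : nat) (b : 'I_n -> V) i : lin_span b (b i).
Proof.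
exists (fun j => (j == i)%:R); rewrite (bigD1 i) //= eqxx scale1r big1 ?addr0 //.
by move=> j /negbTE ->; rewrite scale0r.
Qed.

(** The two matrices of coefficients multiply to the identity since [b] is free,
    and a rectangular matrix with a right inverse has at least as many columns
    as rows. *)
Lemma lin_free_le (n m : nat) (b : 'I_n -> V) (c : 'I_m -> V) :
  lin_free b -> (forall i, lin_span c (b i)) -> (forall j, lin_span b (c j)) ->
  (n <= m)%N.
Proof.
move=> b_free /choice[A bE] /choice[B cE].
pose MA := \matrix_(i < n, j < m) A i j; pose MB := \matrix_(j < m, i < n) B j i.
suff : MA *m MB = 1%:M by apply: mulmx1_min.
apply/matrixP => i k; apply/eqP; rewrite -subr_eq0; apply/eqP.
apply: (b_free (fun k => (MA *m MB) i k - 1%:M i k)).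
under eq_bigr => l _ do rewrite scalerBl !mxE scaler_suml.
rewrite sumrB exchange_big /=.
under eq_bigr => j _.
  under eq_bigr => l _ do rewrite !mxE -scalerA.
  rewrite -scaler_sumr -cE.
  over.
rewrite -bE (bigD1 i) //= eqxx scale1r big1 ?addr0 ?subrr // => l.
by rewrite eq_sym => /negbTE ->; rewrite scale0r.
Qed.

Lemma has_dim_unique (A : set V) (n m : nat) :
  has_dim A n -> has_dim A m -> n = m.
Proof.
move=> [b b_free bA] [c c_free cA]; apply/eqP; rewrite eqn_leq.
have bc i : lin_span c (b i) by rewrite -cA bA; apply: mem_lin_span.
have cb j : lin_span b (c j) by rewrite -bA cA; apply: mem_lin_span.
by rewrite (lin_free_le b_free bc cb) (lin_free_le c_free cb bc).
Qed.

End Dimension.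

(** * Operators defined on a subspace *)

Section LinearOperators.
Variables (K : numFieldType) (X Y : lmodType K).
Implicit Type L : linop X Y.

Lemma linop0 L : L 0 = 0.
Proof.
by have := linopP (-1) (dom0 L) (dom0 L); rewrite scaler0 addr0 scaleN1r addNr.
Qed.

Lemma linop_domZ L a x : dom L x -> dom L (a *: x).
Proof. by move=> Lx; rewrite -[_ *: _]addr0; apply: domP => //; apply: dom0. Qed.

Lemma linop_sum L (n : nat) (a : 'I_n -> K) (x : 'I_n -> X) :
  (forall i, dom L (x i)) ->
  dom L (\sum_i a i *: x i) /\ L (\sum_i a i *: x i) = \sum_i a i *: L (x i).
Proof.
move=> Lx; elim: n a x Lx => [|n IHn] a x Lx.
  by rewrite !big_ord0 linop0; split=> //; apply: dom0.
have [dS LS] := IHn (fun i => a (lift ord0 i)) (fun i => x (lift ord0 i))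
                    (fun i => Lx _).
by rewrite !big_ord_recl linopP // LS; split=> //; apply: domP.
Qed.

Lemma dom_lin_span L (n : nat) (b : 'I_n -> X) :
  (forall i, dom L (b i)) -> lin_span b `<=` dom L.
Proof. by move=> Lb _ [c ->]; apply: (linop_sum c Lb).1. Qed.

Lemma linop_invK L : invertible L -> {in dom L, cancel L (linop_inv L)}.
Proof. by move=> L_inj; apply: pinvKV. Qed.


(** [linop_inv] extends the inverse by 0, so it is linear only on the range
    of [L]. *)
Lemma linop_invP L a x y : invertible L -> (L @` dom L) x -> (L @` dom L) y ->
  linop_inv L (a *: x + y) = a *: linop_inv L x + linop_inv L y.
Proof.
move=> L_inj [u Lu <-] [v Lv <-]; rewrite -linopP //.
by rewrite !linop_invK ?inE //; apply: domP.
Qed.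

End LinearOperators.

(** * Singular value decomposition of the POD operator *)

Section Pod.
Variables (R : realType) (kind : scalar_kind) (X : sepHilbertType R kind).
Local Notation K := (scalars R kind).
Variables (s : nat) (gamma : 'I_s -> K) (w : 'I_s -> X).
Variables (sigma : nat -> K) (f : nat -> 'rV[K]_s) (phi : nat -> X).
Hypothesis gamma_gt0 : forall j, 0 < gamma j.
Hypothesis svd : is_svd (weighted_inner gamma) (inner X) (pod_operator gamma w)
                        sigma f phi.

Lemma sigma_gt0W k l : (0 < k <= l)%N -> 0 < sigma l -> 0 < sigma k.
Proof. by move=> kl /lt_le_trans; apply; apply: svd_nonincreasing svd _ _ kl. Qed.

(** m orthonormal vectors fit into K^s only if m <= s; orthonormality for the
    weighted inner product says that the matrix of the f_k has a right
    inverse. *)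
Lemma sigma_count_le m : (0 < m)%N -> 0 < sigma m -> (m <= s)%N.
Proof.
move=> m0 sm.
pose F := \matrix_(i < m, j < s) f i.+1 0 j.
pose G := \matrix_(j < s, i < m) (gamma j * scalar_conj R kind (f i.+1 0 j)).
suff : F *m G = 1%:M by apply: mulmx1_min.
have s_gt0 (i : 'I_m) : 0 < sigma i.+1 by apply: sigma_gt0W sm => /=.
apply/matrixP => i k; rewrite !mxE.
rewrite -[RHS](svd_orthonormal_l svd (ltn0Sn i) (ltn0Sn k)) //.
by apply: eq_bigr => j _; rewrite !mxE mulrCA mulrA.
Qed.

Lemma sigma_gt0_cutoff :
  exists n, forall k, (0 < k)%N -> (0 < sigma k) = (k <= n)%N.
Proof.
pose P k := (k == 0%N) || (0 < sigma k).
have P0 : exists k, P k by exists 0%N.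
have Ps k : P k -> (k <= s)%N.
  by case: k => [//|k] /orP[//|]; apply: sigma_count_le.
case: (ex_maxnP P0 Ps) => n Pn n_max; exists n => k k0.
apply/idP/idP => [sk|kn]; first by apply: n_max; rewrite /P sk orbT.
case/orP: Pn => [/eqP n0|]; first by move: k0; rewrite lt0n -leqn0 -n0 kn.
by apply: sigma_gt0W; rewrite k0.
Qed.

(** Beyond the last positive singular value the partial sums of the expansion
    are constant, so their limit is one of them. *)
Lemma pod_finite_expansion n g :
  (forall k, (0 < k)%N -> (0 < sigma k) = (k <= n)%N) ->
  pod_operator gamma w g
  = \sum_(i < n) (sigma i.+1 * weighted_inner gamma g (f i.+1)) *: phi i.+1.
Proof.
move=> n_cut.
apply: (norm_cvg_unique (svd_expansion svd (g := g))).
apply: cvg_near_cst; exists n => // m /= nm.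
rewrite (big_cat_nat (n := n.+1)) //= [X in _ + X]big1_seq ?addr0.
  by rewrite big_add1 big_mkord.
move=> k; rewrite mem_index_iota => /= /andP[nk _].
have k0 : (0 < k)%N by apply: leq_trans nk.
have : ~~ (0 < sigma k) by rewrite n_cut // -ltnNge.
rewrite lt_def (svd_ge0 svd k0) andbT negbK => /eqP ->.
by rewrite mul0r scale0r.
Qed.

Variable sX : nat.
Hypothesis rank_sX : has_rank (pod_operator gamma w) sX.

(** The phi_k with positive singular value are a basis of the
    range: they span it by the finite expansion, and each lies in it because
    phi_k is the image of f_k / sigma_k. *)
Lemma sigma_gt0E k : (0 < k)%N -> (0 < sigma k) = (k <= sX)%N.
Proof.
have [n n_cut] := sigma_gt0_cutoff.
suff -> : sX = n by apply: n_cut.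
apply: has_dim_unique rank_sX _; exists (fun i : 'I_n => phi i.+1).
  apply: orthonormal_lin_free => i j.
  by rewrite (svd_orthonormal_r svd) ?n_cut.
rewrite eqEsubset; split=> [_ [g _ <-]|_ [c ->]].
  by rewrite (pod_finite_expansion g n_cut); eexists.
exists (\sum_i (c i / sigma i.+1) *: f i.+1) => //.
rewrite /pod_operator; under eq_bigr => j _.
  rewrite summxE mulr_sumr scaler_suml.
  under eq_bigr => i _ do rewrite mxE mulrCA -scalerA.
  over.
rewrite exchange_big /=; apply: eq_bigr => i _; rewrite -scaler_sumr.
have si : 0 < sigma i.+1 by rewrite n_cut.
rewrite -/(pod_operator gamma w (f i.+1)) (svd_apply svd) // scalerA.
by rewrite divfK // gt_eqF.
Qed.

(** The snapshot w_j is the image of the j-th coordinate vector divided by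
    gamma_j. *)
Lemma snapshot_expansion j :
  w j = \sum_(i < sX)
          (sigma i.+1 * scalar_conj R kind (f i.+1 0 j)) *: phi i.+1.
Proof.
transitivity (pod_operator gamma w ((gamma j)^-1 *: delta_mx 0 j)).
  rewrite /pod_operator (bigD1 j) //= big1 ?addr0 => [|k kj].
    by rewrite !mxE !eqxx mulr1 mulfV ?scale1r // gt_eqF.
  by rewrite !mxE (negbTE kj) andbF !mulr0 scale0r.
rewrite (pod_finite_expansion _ sigma_gt0E); apply: eq_bigr => i _.
congr (_ * _ *: _); rewrite /weighted_inner (bigD1 j) //= big1 ?addr0 => [|k kj].
  by rewrite !mxE !eqxx mulr1 mulfV ?mul1r // gt_eqF.
by rewrite !mxE (negbTE kj) andbF !mulr0 mul0r.
Qed.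

Lemma snapshot_coef_orth i l : (0 < i <= sX)%N -> (0 < l <= sX)%N ->
  \sum_j gamma j * (sigma i * scalar_conj R kind (f i 0 j)
    * scalar_conj R kind (sigma l * scalar_conj R kind (f l 0 j)))
  = (i == l)%:R * sigma i ^+ 2.
Proof.
move=> /andP[i0 isX] /andP[l0 lsX].
under eq_bigr => j _.
  rewrite rmorphM /= scalar_conjK (scalar_conj_ge0 (svd_ge0 svd l0)).
  have -> : gamma j * (sigma i * scalar_conj R kind (f i 0 j)
              * (sigma l * f l 0 j))
            = sigma i * sigma l * (gamma j * f l 0 j
              * scalar_conj R kind (f i 0 j)) by ring.
  over.
rewrite -mulr_sumr -/(weighted_inner gamma (f l) (f i)).
rewrite (svd_orthonormal_l svd) ?sigma_gt0E // eq_sym mulrC.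
by case: eqP => [->|_]; rewrite ?mul0r // expr2.
Qed.

Lemma dom_phi (Y : lmodType K) (L : linop X Y) k : (forall j, dom L (w j)) ->
  (0 < k <= sX)%N -> dom L (phi k).
Proof.
move=> Lw /andP[k0 ksX].
have sk : 0 < sigma k by rewrite sigma_gt0E.
have -> : phi k = (sigma k)^-1 *: pod_operator gamma w (f k).
  by rewrite (svd_apply svd) // scalerA mulVf ?scale1r // gt_eqF.
by apply: linop_domZ; apply: (linop_sum _ Lw).1.
Qed.

(** The common core of the three error formulas. [E] may be unbounded: only
    finite sums pass through it. *)
Lemma pod_sqnorm_sum (Z : sepHilbertType R kind) (E : linop X Z) :
  (forall j, dom E (w j)) ->
  \sum_j gamma j * `|E (w j)| ^+ 2
  = \sum_(1 <= k < sX.+1) sigma k ^+ 2 * `|E (phi k)| ^+ 2.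
Proof.
move=> Ew; rewrite big_add1 big_mkord.
under eq_bigr => j _.
  rewrite snapshot_expansion (linop_sum _ _).2; last first.
    by move=> i; apply: dom_phi => //=.
  over.
by apply: weighted_sqnorm_sum => i l; apply: snapshot_coef_orth => /=.
Qed.

Lemma pod_sqnorm_tail (Z : sepHilbertType R kind) (E : linop X Z) r :
  (forall j, dom E (w j)) -> (r <= sX)%N ->
  (forall k, (0 < k <= r)%N -> E (phi k) = 0) ->
  \sum_j gamma j * `|E (w j)| ^+ 2
  = \sum_(r.+1 <= k < sX.+1) sigma k ^+ 2 * `|E (phi k)| ^+ 2.
Proof.
move=> Ew rsX E0; rewrite pod_sqnorm_sum // (big_cat_nat (n := r.+1)) //=.
rewrite big1_seq ?add0r // => k; rewrite mem_index_iota => /= kr.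
by rewrite E0 // normr0 expr0n mulr0.
Qed.

Lemma mem_pod_space r k : (0 < k <= r)%N -> pod_space phi r (phi k).
Proof.
case: k => // k kr.
exact: (mem_lin_span (fun i : 'I_r => phi i.+1) (Ordinal kr)).
Qed.

(** For k > r, phi_k is orthogonal to X_r, hence so is its projection, which
    lies in X_r and is therefore orthogonal to itself. *)
Lemma orthogonal_projection_phi0 (PX : {linear X -> X}) r k :
  orthogonal_projection (inner X) (pod_space phi r) PX ->
  (r < k <= sX)%N -> PX (phi k) = 0.
Proof.
move=> [[_ PX_range] PX_orth] /andP[rk ksX].
have Pphi : pod_space phi r (PX (phi k)) by rewrite -PX_range; exists (phi k).
have phi_orth : inner X (phi k) (PX (phi k)) = 0.
  have [c ->] := Pphi; rewrite inner_sumr big1 // => i _.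
  have ik : (i.+1 < k)%N by apply: leq_ltn_trans rk.
  have k0 : (0 < k)%N by apply: leq_trans ik.
  rewrite (svd_orthonormal_r svd) ?sigma_gt0E ?(leq_trans (ltnW ik)) //.
  by rewrite gtn_eqF ?mulr0.
have /eqP := PX_orth (phi k) _ Pphi.
by rewrite inner_subl phi_orth sub0r oppr_eq0 => /eqP; apply: inner_self_eq0.
Qed.

End Pod.

(** * Projections and the error formulas *)

Lemma projection_onto_id (K : numFieldType) (V : lmodType K) (A : set V)
    (P : {linear V -> V}) x :
  projection_onto A P -> A x -> P x = x.
Proof. by move=> [PP <-] [y _ <-]; apply: PP. Qed.

Lemma projection_onto_mem (K : numFieldType) (V : lmodType K) (A : set V)
    (P : {linear V -> V}) x :
  projection_onto A P -> A (P x).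
Proof. by move=> [_ <-]; exists x. Qed.

Theorem theorem5p1
  (R : realType) (kind : scalar_kind) (X Y : sepHilbertType R kind)
  (L : linop X Y)
  (s : nat) (s_gt0 : (0 < s)%N)
  (gamma : 'I_s -> scalars R kind) (gamma_gt0 : forall j, 0 < gamma j)
  (w : 'I_s -> X) (w_dom : forall j, dom L (w j))
  (sigma : nat -> scalars R kind)
  (f : nat -> 'rV[scalars R kind]_s) (phi : nat -> X)
  (svd : is_svd (weighted_inner gamma) (inner X) (pod_operator gamma w)
                sigma f phi)
  (sX : nat) (rank_sX : has_rank (pod_operator gamma w) sX)
  (r : nat) (r_gt0 : (0 < r)%N) (sigma_r_gt0 : 0 < sigma r)
  (PX : {linear X -> X})
  (PX_proj : orthogonal_projection (inner X) (pod_space phi r) PX)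
  (PY : {linear Y -> Y})
  (PY_bounded : bounded_operator PY)
  (PY_proj : projection_onto (L @` pod_space phi r) PY) :
  [/\ \sum_j gamma j * `|L (w j) - L (PX (w j))| ^+ 2
        = \sum_(r.+1 <= k < sX.+1) sigma k ^+ 2 * `|L (phi k)| ^+ 2,
      \sum_j gamma j * `|L (w j) - PY (L (w j))| ^+ 2
        = \sum_(r.+1 <= k < sX.+1)
            sigma k ^+ 2 * `|L (phi k) - PY (L (phi k))| ^+ 2
    & invertible L ->
      \sum_j gamma j * `|w j - linop_inv L (PY (L (w j)))| ^+ 2
        = \sum_(r.+1 <= k < sX.+1)
            sigma k ^+ 2
              * `|phi k - linop_inv L (PY (L (phi k)))| ^+ 2].
Proof.
have sigmaE := sigma_gt0E svd rank_sX.
have rsX : (r <= sX)%N by rewrite -sigmaE.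
have phi_dom k : (0 < k <= sX)%N -> dom L (phi k).
  by apply: (dom_phi svd rank_sX w_dom).
have Xr_dom : pod_space phi r `<=` dom L.
  by apply: dom_lin_span => i; apply: phi_dom; rewrite (leq_trans _ rsX).
have PX_dom x : dom L (PX x).
  by apply: Xr_dom; apply: projection_onto_mem PX_proj.1.
have PY_im y : (L @` dom L) (PY y).
  have [x Xx <-] := projection_onto_mem y PY_proj.
  by exists x => //; apply: Xr_dom.
have PY_phi k : (0 < k <= r)%N -> PY (L (phi k)) = L (phi k).
  move=> kr; apply: (projection_onto_id PY_proj).
  by exists (phi k) => //; apply: mem_pod_space.
split.
- have E1P a x y : dom L x -> dom L y ->
      L (a *: x + y) - L (PX (a *: x + y))
      = a *: (L x - L (PX x)) + (L y - L (PX y)).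
    by move=> Lx Ly; rewrite linearP !linopP // scalerBr opprD addrACA.
  rewrite (pod_sqnorm_tail gamma_gt0 svd rank_sX
            (E := LinOp (dom0 L) (@domP _ _ _ L) E1P) w_dom rsX) /=.
    apply: eq_big_nat => k /andP[rk ksX].
    rewrite (orthogonal_projection_phi0 svd rank_sX PX_proj) ?rk //.
    by rewrite linop0 subr0.
  move=> k kr; rewrite (projection_onto_id PX_proj.1) ?subrr //.
  exact: mem_pod_space.
- have E2P a x y : dom L x -> dom L y ->
      L (a *: x + y) - PY (L (a *: x + y))
      = a *: (L x - PY (L x)) + (L y - PY (L y)).
    by move=> Lx Ly; rewrite !linopP // linearP scalerBr opprD addrACA.
  apply: (pod_sqnorm_tail gamma_gt0 svd rank_sX
            (E := LinOp (dom0 L) (@domP _ _ _ L) E2P) w_dom rsX) => k kr /=.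
  by rewrite PY_phi ?subrr.
- move=> L_inj.
  have E3P a x y : dom L x -> dom L y ->
      a *: x + y - linop_inv L (PY (L (a *: x + y)))
      = a *: (x - linop_inv L (PY (L x))) + (y - linop_inv L (PY (L y))).
    move=> Lx Ly; rewrite linopP // linearP linop_invP //.
    by rewrite scalerBr opprD addrACA.
  apply: (pod_sqnorm_tail gamma_gt0 svd rank_sX
            (E := LinOp (dom0 L) (@domP _ _ _ L) E3P) w_dom rsX) => k kr /=.
  rewrite PY_phi // linop_invK ?subrr // inE.
  by apply: phi_dom; case/andP: kr => -> kr; apply: leq_trans rsX.
Qed.
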